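(* Let $F_{\mathcal N}(x,s):=\sum_{u\in L'}a_u(s)\,x^{v+Bs+u}$ and $\widetilde F_{\mathcal N}(x,s):=m(s)\,F_{\mathcal N}(x,s)$. Then for every $q(\partial_s)\in P_{\mathcal N}^{\perp}$, the series $\bigl(q(\partial_s)\bullet\widetilde F_{\mathcal N}(x,s)\bigr)_{|s=0}$ is a solution to $M_A(\beta)$.
   Context: $\mathbb N=\{0,1,2,\dots\}$. $A=(a_{ij})$ is a $d\times n$ integer matrix of rank $d$ which is homogeneous: all its columns lie on one hyperplane of $\mathbb Q^d$ not passing through the origin. $L=\{u\in\mathbb Z^n: Au=0\}$. Each $u\in\mathbb Z^n$ is written uniquely as $u=u_+-u_-$ with $u_\pm\in\mathbb N^n$ of disjoint supports. $I_A=\langle\partial^u-\partial^{u'}: u,u'\in\mathbb N^n, Au=Au'\rangle\subset\mathbb C[\partial_1,\dots,\partial_n]$. For $\beta\in\mathbb C^d$, $H_A(\beta)$ is the left ideal of the Weyl algebra $D=\mathbb C\langle x_1,\dots,x_n,\partial_1,\dots,\partial_n\rangle$ generated by $I_A$ and $\sum_j a_{ij}\theta_j-\beta_i$ ($i=1,\dots,d$), $\theta_j=x_j\partial_j$, and $M_A(\beta)=D/H_A(\beta)$. A solution to $M_A(\beta)$ is a (formal, possibly logarithmic) series annihilated by $H_A(\beta)$. For $v\in\mathbb C^n$ and $u\in\mathbb N^n$, $[v]_u=\prod_{j=1}^n v_j(v_j-1)\cdots(v_j-u_j+1)$ (same formula when the entries of $v$ are polynomials in $s$). $\mathrm{nsupp}(v)=\{j: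 v_j\in\mathbb Z_{<0}\}$. Fix a generic weight $w\in\mathbb R^n$ (in particular $\mathrm{in}_w(I_A)$ is a monomial ideal) and a fake exponent $v$ of $H_A(\beta)$ with respect to $w$, i.e. $Av=\beta$ and $[v]_{u_+}=0$ for all $u\in L$ with $u_+\cdot w>u_-\cdot w$. Write $I_u:=\mathrm{nsupp}(v+u)$ for $u\in L$. Let $B=\{b^{(1)},\dots,b^{(h)}\}\subset L$ be linearly independent, also regarded as the $n\times h$ matrix with these columns; $\mathrm{supp}(B)$ is the set of indices of nonzero rows of $B$. Assume $I_0\subset\mathrm{supp}(B)\cup I_u$ for all $u\in L$. Let $s=(s_1,\dots,s_h)^T$ be indeterminates, $(Bs)_j=\sum_k b^{(k)}_js_k$, $(Bs)^J=\prod_{j\in J}(Bs)_j$ for $J\subset\{1,\dots,n\}$. For $u\in L$, $a_u(s)=[v+Bs]_{u_-}/[v+Bs+u]_{u_+}$ (the denominator is nonzero by the assumption on $B$). Let $\{\partial^{g^{(i)}_+}-\partial^{g^{(i)}_-}: i=1,\dots,M\}$ be the reduced Gröbner basis of $I_A$ with respect to $w$, with $\partial^{g^{(i)}_+}\in\mathrm{in}_w(I_A)$, and $C(w)=\sum_i\mathbb N g^{(i)}$. Put $\mathrm{NS}_w(v)=\{I_u: u\in L,\text{ and every }u'\in L\text{ with }I_{u'}=I_u\text{ lies in }C(w)\}$, $\mathcal N=\{I\in\mathrm{NS}_w(v):\mathrm{supp}(B)\cup I=\mathrm{supp}(B)\cup I_0\}$, $\mathcal N^c=\{I_u: u\in L,\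 \mathrm{supp}(B)\cup I_u=\mathrm{supp}(B)\cup I_0\}\setminus\mathcal N$, $L'=\{u\in L: I_u\in\mathcal N\}$ (so $L'\subset C(w)$), $K_{\mathcal N}=\bigcap_{I\in\mathcal N}I$, $m(s)=(Bs)^{I_0\setminus K_{\mathcal N}}$, and $P_{\mathcal N}=\langle (Bs)^{(I\cup J)\setminus K_{\mathcal N}}: I\in\mathcal N, J\in\mathcal N^c\rangle\subset\mathbb C[s]$. For a homogeneous ideal $P\subset\mathbb C[s]$, $P^\perp=\{q(\partial_s)\in\mathbb C[\partial_{s_1},\dots,\partial_{s_h}]: (q(\partial_s)\bullet h(s))_{|s=0}=0\ \text{for all } h\in P\}$. Here $\bullet$ is the action of differential operators, $x^{v+Bs+u}$ is regarded as $x^{v+u}\exp\bigl(\sum_{j,k}(\log x_j)b^{(k)}_js_k\bigr)$, and $q(\partial_s)\bullet$ and evaluation at $s=0$ are applied termwise (each $m(s)a_u(s)$ with $u\in L'$ is a power series in $s$). *)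

(* Defs.v *)
From HB Require Import structures.
From mathcomp Require Import all_boot all_order all_algebra.
From mathcomp Require Import boolp classical_sets functions cardinality fsbigop reals.
From mathcomp Require Import complex mpoly fraction.

Set Implicit Arguments.
Unset Strict Implicit.
Unset Printing Implicit Defensive.

Import Order.TTheory GRing.Theory Num.Theory.
Local Open Scope ring_scope.
Local Open Scope classical_set_scope.

Definition ideal_gen (T : pzRingType) (S : set T) : set T :=
  [set p | exists k (c g : 'I_k -> T),
     (forall i, S (g i)) /\ p = \sum_i c i * g i].

Definition multi_iter (n : nat) (V : Type) (op : 'I_n -> V -> V)
    (m : 'X_{1..n}) (x : V) : V :=
  foldr (fun j => iter (m j) (op j)) x (enum 'I_n).

(* [mpoly_act op p] is p(op_1, ..., op_n), for commuting operators op_j. *)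
Definition mpoly_act (K : fieldType) (n : nat) (V : lmodType K)
    (op : 'I_n -> V -> V) (p : {mpoly K[n]}) (x : V) : V :=
  \sum_(m <- msupp p) p@_m *: multi_iter op m x.

Section IntegerVectors.
Variable n : nat.
Implicit Types u : 'cV[int]_n.

Definition posv u : 'X_{1..n} := [multinom absz (Num.max (u j 0%R) 0%R) | j < n].
Definition negv u : 'X_{1..n} := posv (- u).

Definition colv (m : 'X_{1..n}) : 'cV[int]_n := \col_j (m j)%:Z.

Definition lattice (d : nat) (A : 'M[int]_(d, n)) : set 'cV[int]_n :=
  [set u | A *m u = 0].

Definition homogeneous_mx (d : nat) (A : 'M[int]_(d, n)) : Prop :=
  exists (c : 'rV[rat]_d) (e : rat),
    [/\ c != 0, e != 0 & c *m map_mx intr A = const_mx e].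

Definition nat_cone (M : nat) (g : 'I_M -> 'cV[int]_n) : set 'cV[int]_n :=
  [set u | exists c : 'I_M -> nat, u = \sum_i g i *+ c i].

Definition weight (R : numDomainType) (w : 'cV[R]_n) (m : 'X_{1..n}) : R :=
  \sum_j w j 0 * (m j)%:R.

End IntegerVectors.

Section ToricIdeal.
Variables (C : fieldType) (R : realDomainType) (d n : nat).
Variables (A : 'M[int]_(d, n)) (w : 'cV[R]_n).
Implicit Types (p q : {mpoly C[n]}) (I : set {mpoly C[n]}).

(* C[\partial_1, ..., \partial_n] is {mpoly C[n]}, \partial_j being 'X_j. *)
Definition toric_ideal : set {mpoly C[n]} :=
  ideal_gen [set p | exists a b : 'X_{1..n},
    A *m colv a = A *m colv b /\ p = 'X_[a] - 'X_[b]].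

Definition box (u : 'cV[int]_n) : {mpoly C[n]} := 'X_[posv u] - 'X_[negv u].

Definition in_form p : {mpoly C[n]} :=
  \sum_(m <- msupp p | all (fun m' => weight w m' <= weight w m) (msupp p))
     p@_m *: 'X_[m].

Definition in_ideal I : set {mpoly C[n]} := ideal_gen (in_form @` I).

Definition monomial_ideal I : Prop :=
  exists S : set 'X_{1..n}, I = ideal_gen [set 'X_[m] | m in S].

(* Reduced Groebner basis for a weight w such that in_w(I) is a monomial
   ideal; there in_w(p) is a monomial for every p in the reduced basis. *)
Definition reduced_groebner I (G : set {mpoly C[n]}) : Prop :=
  [/\ finite_set G,
      G `<=` I,
      in_ideal I = ideal_gen (in_form @` G)
    & forall p, G p ->
        (exists m, in_form p = 'X_[m]) /\
        (forall m, m \in msupp p ->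
           ~ ideal_gen (in_form @` (G `\ p)) 'X_[m])].

End ToricIdeal.

(* A formal logarithmic series \sum_gamma p_gamma(log x) x^gamma, with gamma
   in C^n: the variable 'X_j of p_gamma stands for log x_j. *)
Definition logseries (C : fieldType) (n : nat) : Type :=
  'cV[C]_n -> {mpoly C[n]}.
HB.instance Definition _ (C : fieldType) (n : nat) :=
  GRing.Lmodule.on (logseries C n).

Section Weyl.
Variables (C : fieldType) (d n : nat).
Local Notation LS := (logseries C n).

Definition lsX (j : 'I_n) (f : LS) : LS := fun gam => f (gam - delta_mx j 0).

(* \partial_j (x^gam p(log x))
     = x^(gam - e_j) (gam_j p + (\partial p / \partial log x_j))(log x) *)
Definition lsD (j : 'I_n) (f : LS) : LS := fun gam =>
  let gam1 := gam + delta_mx j 0 in gam1 j 0 *: f gam1 + mderiv j (f gam1).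

(* The Weyl algebra, as the algebra of operators on logarithmic series
   generated by C, the x_j and the \partial_j. In characteristic 0 this
   representation is faithful: already C[x], the span of the monomials x^gam
   with gam in N^n, is a faithful submodule. *)
Inductive weyl : (LS -> LS) -> Prop :=
| weyl_const c : weyl (fun f => c *: f)
| weyl_x j : weyl (lsX j)
| weyl_d j : weyl (lsD j)
| weyl_add P Q : weyl P -> weyl Q -> weyl (fun f => P f + Q f)
| weyl_mul P Q : weyl P -> weyl Q -> weyl (fun f => P (Q f)).

Definition left_ideal_gen (S : set (LS -> LS)) : set (LS -> LS) :=
  [set T | exists k (P G : 'I_k -> LS -> LS),
     (forall i, weyl (P i) /\ S (G i)) /\
     T = (fun f => \sum_i P i (G i f))].

Variables (A : 'M[int]_(d, n)) (beta : 'cV[C]_d).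

Definition euler_op (i : 'I_d) (f : LS) : LS :=
  \sum_j (A i j)%:~R *: lsX j (lsD j f) - beta i 0 *: f.

Definition hypergeometric_ideal : set (LS -> LS) :=
  left_ideal_gen
    ([set T | exists2 p, toric_ideal A p & T = mpoly_act lsD p] `|`
     range euler_op).

Definition is_solution (f : LS) : Prop :=
  forall T, hypergeometric_ideal T -> T f = 0.

End Weyl.

(* Power series K[[s_1, ..., s_h]], as families of coefficients. *)
Definition mseries (K : Type) (h : nat) : Type := 'X_{1..h} -> K.
HB.instance Definition _ (C : fieldType) (V : lmodType C) (h : nat) :=
  GRing.Lmodule.on (mseries V h).

Section PowerSeries.
Variable h : nat.

Definition series_of_mpoly (K : nzRingType) (p : {mpoly K[h]}) : mseries K h :=
  fun m => p@_m.

Definition smul (K : nzRingType) (f g : mseries K h) : mseries K h :=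
  fun m => \sum_(k : 'X_{1..h < (mdeg m).+1} | (k <= m)%MM)
             f k * g (m - k)%MM.

Definition sderiv (V : nmodType) (k : 'I_h) (f : mseries V h) : mseries V h :=
  fun m => f (m + U_(k))%MM *+ (m k).+1.

(* The power series g equal to f, i.e. with Q g = P when f = P / Q; it is
   unique if it exists, and the value is junk otherwise. *)
Definition series_of_frac (C : fieldType) (f : {fraction {mpoly C[h]}}) :
    mseries C h :=
  xget (fun=> 0) [set g | exists P Q : {mpoly C[h]},
    [/\ Q != 0, f = tofrac P / tofrac Q
      & smul (series_of_mpoly Q) g = series_of_mpoly P]].

(* exp(f) for f without constant term, so that f ^ k does not contribute to
   the coefficient of s^m for k > |m|. *)
Definition sexp (C : fieldType) (n : nat) (f : {mpoly {mpoly C[n]}[h]}) :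
    mseries {mpoly C[n]} h :=
  fun m => \sum_(k < (mdeg m).+1) (k`!%:R^-1 : C) *: (f ^+ k)@_m.

(* Meant for homogeneous ideals P. *)
Definition perp (C : fieldType) (P : set {mpoly C[h]}) : set {mpoly C[h]} :=
  [set q | forall p, P p -> (mpoly_act (@mderiv h C) q p).@[fun=> 0] = 0].

End PowerSeries.

Section Frobenius.
Variables (C : fieldType) (d n h M : nat).
Variables (A : 'M[int]_(d, n)) (v : 'cV[C]_n) (B : 'M[int]_(n, h)).
Variable g : 'I_M -> 'cV[int]_n.
Implicit Types (u : 'cV[int]_n) (I J : {set 'I_n}).

Definition descfact (T : pzRingType) (x : 'cV[T]_n) (m : 'X_{1..n}) : T :=
  \prod_j \prod_(i < m j) (x j 0 - i%:R).

Definition fake_exponent (R : realDomainType) (beta : 'cV[C]_d)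
    (w : 'cV[R]_n) : Prop :=
  map_mx intr A *m v = beta /\
  forall u, lattice A u -> weight w (posv u) > weight w (negv u) ->
    descfact v (posv u) = 0.

Definition nsupp (x : 'cV[C]_n) : {set 'I_n} :=
  [set j | `[< exists k : nat, x j 0 = - k.+1%:R >]]%SET.

Definition I_ u : {set 'I_n} := nsupp (v + map_mx intr u).

Definition supp_mx : {set 'I_n} := [set j | row j B != 0]%SET.

Definition NS : {set {set 'I_n}} :=
  [set I | `[< exists u, [/\ lattice A u, I_ u = I
     & forall u', lattice A u' -> I_ u' = I -> nat_cone g u'] >]]%SET.

Definition calN : {set {set 'I_n}} :=
  [set I in NS | supp_mx :|: I == supp_mx :|: I_ 0]%SET.

Definition calNc : {set {set 'I_n}} :=
  ([set I | `[< exists u, [/\ lattice A u, I_ u = I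
      & supp_mx :|: I_ u = supp_mx :|: I_ 0] >]] :\: calN)%SET.

Definition L' : set 'cV[int]_n := [set u | lattice A u /\ I_ u \in calN].

Definition K_N : {set 'I_n} := (\bigcap_(I in calN) I)%SET.

Definition Bs : 'cV[{mpoly C[h]}]_n := map_mx intr B *m (\col_k 'X_k).

Definition Bs_prod J : {mpoly C[h]} := \prod_(j in J) Bs j 0.

Definition vBs : 'cV[{mpoly C[h]}]_n := map_mx (@mpolyC h C) v + Bs.

Definition a_ u : {fraction {mpoly C[h]}} :=
  tofrac (descfact vBs (negv u)) /
  tofrac (descfact (vBs + map_mx intr u) (posv u)).

Definition m_s : {mpoly C[h]} := Bs_prod (I_ 0 :\: K_N)%SET.

Definition P_N : set {mpoly C[h]} :=
  ideal_gen [set p | exists I J, [/\ I \in calN, J \in calNc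
    & p = Bs_prod ((I :|: J) :\: K_N)%SET]].

(* \sum_(j, k) (log x_j) b^(k)_j s_k *)
Definition log_Bs : {mpoly {mpoly C[n]}[h]} :=
  \sum_(k < h) ((\sum_(j < n) (B j k)%:~R *: 'X_j : {mpoly C[n]})) *: 'X_k.

(* The coefficient of x^(v+u) in m(s) a_u(s) x^(v+Bs+u), an element of
   C[log x][[s]]. *)
Definition Ftilde_term u : mseries {mpoly C[n]} h :=
  smul (fun m => (series_of_frac (tofrac m_s * a_ u) m)%:MP) (sexp log_Bs).

(* (q(\partial_s) \bullet Ftilde_N(x, s))_(|s=0), computed termwise: the term
   of index u in L' contributes to the exponent v + u only. *)
Definition Ftilde_at0 (q : {mpoly C[h]}) : logseries C n := fun gam =>
  \sum_(u \in [set u | L' u /\ v + map_mx intr u = gam])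
     mpoly_act (@sderiv h {mpoly C[n]}) q (Ftilde_term u) 0%MM.

End Frobenius.

(* Main.v *)
From HB Require Import structures.
Require Import Defs.
From mathcomp Require Import all_boot all_order all_algebra.
From mathcomp Require Import boolp classical_sets functions cardinality fsbigop reals.
From mathcomp Require Import complex ssrcomplements mpoly fraction.
From mathcomp Require Import ring zify.

(** Termwise, the coefficient of [x^(v+Bs+u)] behaves like [1/Gamma(v+Bs+u+1)]:
    [[v+Bs+u]_a a_u = [v+Bs+u']_b a_u'] whenever [u - a = u' - b]. Hence in
    [(\partial^a - \partial^b)] applied to [F_N], with [A a = A b], all terms
    cancel except those where exactly one of [u], [u'] belongs to [L'].
    If [u] does and [u'] does not, counting the factors of [[v+Bs+u]_a a_u]
    that vanish at [s = 0] shows that [m(s) [v+Bs+u]_a a_u(s)] is the product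
    of [(Bs)^((I_u \cup I_u') \ K_N)] and a power series. Either [I_u'] lies in
    [N^c] and this monomial is a generator of [P_N], or [I_u'] contains an
    index outside [supp B], and this monomial is [0]; in both cases an operator
    in the orthogonal of [P_N] kills the term at [s = 0]. The Euler operators
    act on each term by the scalar [A (v + Bs + u) - beta = 0]. *)

Import Order.TTheory GRing.Theory Num.Theory.
Local Open Scope ring_scope.
Local Open Scope classical_set_scope.

Set Implicit Arguments.
Unset Strict Implicit.
Unset Printing Implicit Defensive.

(** * Operators acting through polynomials *)

Section MultiIter.
Variable n : nat.

Lemma multi_iter_morph (V W : Type) (phi : V -> W)
    (op : 'I_n -> V -> V) (op' : 'I_n -> W -> W) m x :
  (forall j y, phi (op j y) = op' j (phi y)) ->
  phi (multi_iter op m x) = multi_iter op' m (phi x).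
Proof.
move=> phiE; rewrite /multi_iter; elim: (enum _) => //= j l <-.
by elim: (m j) => //= k IH; rewrite phiE IH.
Qed.

(** An index set independent of the support of [p] lets polynomials with different supports be
    compared coefficient by coefficient. *)
Lemma mpoly_act_wide (K : fieldType) (V : lmodType K) (op : 'I_n -> V -> V)
    (p : {mpoly K[n]}) x k : (msize p <= k)%N ->
  mpoly_act op p x =
  \sum_(m : 'X_{1..n < k}) p@_m *: multi_iter op m x.
Proof.
move=> pk; pose I : subFinType _ := 'X_{1..n < k}.
rewrite /mpoly_act (big_mksub I) //=; first last.
- by move=> m /msize_mdeg_lt /leq_trans; apply.
- exact: msupp_uniq.
rewrite [RHS](bigID (fun i : 'X_{1..n < k} => val i \in msupp p)) /=.
by rewrite [X in _ + X]big1 ?addr0 // => m /memN_msupp_eq0 ->; rewrite scale0r.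
Qed.

(** The polynomial comes last so that linearity in it can be registered. *)
Definition mpoly_act_on (K : fieldType) (V : lmodType K) (op : 'I_n -> V -> V)
  (x : V) (p : {mpoly K[n]}) : V := mpoly_act op p x.

Lemma mpoly_act_on_linear (K : fieldType) (V : lmodType K)
    (op : 'I_n -> V -> V) x : linear (mpoly_act_on op x).
Proof.
move=> a p q; pose k := maxn (maxn (msize p) (msize q)) (msize (a *: p + q)).
rewrite /mpoly_act_on !(@mpoly_act_wide _ _ op _ x k) /k; do ?lia.
rewrite scaler_sumr -big_split /=; apply: eq_bigr => m _.
by rewrite linearP /= scalerDl scalerA.
Qed.

HB.instance Definition _ (K : fieldType) (V : lmodType K)
    (op : 'I_n -> V -> V) (x : V) :=
  GRing.isLinear.Build K {mpoly K[n]} V _ (mpoly_act_on op x)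
    (mpoly_act_on_linear op x).

Lemma mpoly_actX (K : fieldType) (V : lmodType K) (op : 'I_n -> V -> V) m x :
  mpoly_act_on op x 'X_[m] = multi_iter op m x.
Proof. by rewrite /mpoly_act_on /mpoly_act msuppX big_seq1 mcoeffX eqxx scale1r. Qed.

End MultiIter.

(** * Formal power series *)

Section SeriesProduct.
Variable h : nat.
Implicit Type m : 'X_{1..h}.

(** Congruence modulo terms of degree above [N]. Identities between power series are reduced to
    identities between their truncations in the polynomial ring. *)
Definition eq_upto (K : nzRingType) N (f : mseries K h) (p : {mpoly K[h]}) :=
  forall m, (mdeg m <= N)%N -> f m = p@_m.

Definition trunc (K : nzRingType) N (f : mseries K h) : {mpoly K[h]} :=
  \sum_(m : 'X_{1..h < N.+1}) f m *: 'X_[m].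

Lemma trunc_upto (K : nzRingType) N (f : mseries K h) : eq_upto N f (trunc N f).
Proof. by move=> m mN; rewrite mcoeff_mpoly ?ltnS. Qed.

Lemma mpoly_upto (K : nzRingType) N (p : {mpoly K[h]}) :
  eq_upto N (series_of_mpoly p) p.
Proof. by []. Qed.

(** A coefficient of degree at most [N] in a product involves only coefficients of degree at most
    [N] of the factors. *)
Lemma smul_upto (K : nzRingType) N (f g : mseries K h) p q :
  eq_upto N f p -> eq_upto N g q -> eq_upto N (smul f g) (p * q).
Proof.
move=> fp gq m mN; rewrite (@mcoeff_poly_mul_lin _ _ p q m (mdeg m).+1) ?ltnSn //.
apply: eq_bigr => k km; rewrite fp ?gq //.
  by rewrite (leq_trans (mdegB _ _)).
by move/lemc_mdeg: (lem_leo km) => /leq_trans; apply.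
Qed.

Lemma upto_eq (K : nzRingType) (f g : mseries K h) :
  (forall N, exists2 p, eq_upto N f p & eq_upto N g p) -> f = g.
Proof.
by move=> fg; apply/funext => m; have [p fp gp] := fg (mdeg m); rewrite fp ?gp.
Qed.

Lemma smulA (K : nzRingType) : associative (@smul h K).
Proof.
move=> f g k; apply: upto_eq => N.
exists (trunc N f * (trunc N g * trunc N k)); last rewrite mulrA;
  by do !apply: smul_upto; apply: trunc_upto.
Qed.

Lemma smulC (K : comNzRingType) : commutative (@smul h K).
Proof.
move=> f g; apply: upto_eq => N; exists (trunc N f * trunc N g);
  last rewrite mulrC; by apply: smul_upto; apply: trunc_upto.
Qed.

Lemma smulCA (K : comNzRingType) : left_commutative (@smul h K).
Proof. by move=> f g k; rewrite !smulA (smulC f). Qed.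

Lemma smulM (K : nzRingType) (p q : {mpoly K[h]}) :
  series_of_mpoly (p * q) = smul (series_of_mpoly p) (series_of_mpoly q).
Proof. by apply: upto_eq => N; exists (p * q) => //; apply: smul_upto. Qed.

Lemma smul_linearl (K : nzRingType) a (p q : {mpoly K[h]}) f m :
  smul (series_of_mpoly (a *: p + q)) f m =
  a * smul (series_of_mpoly p) f m + smul (series_of_mpoly q) f m.
Proof.
rewrite /smul mulr_sumr -big_split /=; apply: eq_bigr => k _.
by rewrite /series_of_mpoly mcoeffD mcoeffZ mulrDl mulrA.
Qed.

Lemma smul1s (K : nzRingType) (f : mseries K h) :
  smul (series_of_mpoly 1) f = f.
Proof.
apply: upto_eq => N; exists (1 * trunc N f); last rewrite mul1r;
  [apply: smul_upto => // | ]; exact: trunc_upto.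
Qed.

Lemma smul0s (K : nzRingType) (f : mseries K h) : smul (fun=> 0) f = fun=> 0.
Proof. by apply/funext => m; rewrite /smul big1 // => k _; rewrite mul0r. Qed.

Lemma smuls0 (K : nzRingType) (f : mseries K h) : smul f (fun=> 0) = fun=> 0.
Proof. by apply/funext => m; rewrite /smul big1 // => k _; rewrite mulr0. Qed.

Lemma series_min_coeff (K : nzRingType) (f : mseries K h) :
  f <> (fun=> 0) -> exists2 m, f m != 0 & forall k, (k < m)%O -> f k = 0.
Proof.
move=> f0; apply: contrapT => nomin; apply: f0; apply/funext.
apply: (@ltmwf h) => m IH; apply: contrapT => fm; apply: nomin.
by exists m => //; apply/eqP.
Qed.

(** The monomial order is well founded and compatible with addition, so the lowest terms at [a] and
    [b] contribute the only nonzero summand to the coefficient at [a + b]. *)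
Lemma smul_eq0 (K : idomainType) (f g : mseries K h) :
  f <> (fun=> 0) -> smul f g = (fun=> 0) -> g = fun=> 0.
Proof.
move=> /series_min_coeff[a fa amin] fg0; apply: contrapT.
move=> /series_min_coeff[b gb bmin].
have /(congr1 (fun s => s (a + b)%MM)) := fg0; apply/eqP.
have aD : (mdeg a < (mdeg (a + b)).+1)%N by rewrite ltnS mdegD leq_addr.
rewrite /smul (bigD1 (BMultinom aD)) ?lem_addr //= big1 ?addr0.
  by rewrite addmC addmK mulf_neq0.
move=> k /andP[kab ka]; have [ltka|leak] := ltP (val k) a.
  by rewrite amin ?mul0r.
have {leak} ltak : (a < val k)%O.
  by rewrite lt_neqAle leak eq_sym andbT; rewrite -(inj_eq val_inj) in ka.
rewrite (bmin (a + b - k)%MM) ?mulr0 // -(ltmc_add2l _ _ k) submK //.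
by rewrite (addmC b); move: ltak; rewrite -(ltmc_add2l _ _ b).
Qed.

Lemma smulrI (K : idomainType) (p : {mpoly K[h]}) (f g : mseries K h) :
  p != 0 -> smul (series_of_mpoly p) f = smul (series_of_mpoly p) g -> f = g.
Proof.
move=> p0 pfg; have pn0 : series_of_mpoly p <> fun=> 0.
  move=> ps0; case/eqP: p0; apply/mpolyP => m.
  by rewrite mcoeff0 -[LHS]/(series_of_mpoly p m) ps0.
have /(smul_eq0 pn0) fg0 : smul (series_of_mpoly p) (fun m => f m - g m) = fun=> 0.
  apply/funext => m.
  transitivity (smul (series_of_mpoly p) f m - smul (series_of_mpoly p) g m).
    by rewrite /smul -sumrB; apply: eq_bigr => k _; rewrite mulrBr.
  by rewrite pfg subrr.
by apply/funext => m; apply/eqP; rewrite -subr_eq0 (congr1 (fun s => s m) fg0).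
Qed.

(** Each factor [p] raises the order by at least one. This makes the geometric and exponential
    series finite in each degree. *)
Lemma mcoeff_expr_ord0 (K : comNzRingType) (p : {mpoly K[h]}) k m :
  p@_0 = 0 -> (mdeg m < k)%N -> (p ^+ k)@_m = 0.
Proof.
move=> p0; elim: k m => // k IH m mk.
rewrite exprS mcoeffM big1 // => -[i j] /= /eqP mE.
have [->|i0] := eqVneq (val i) 0%MM; first by rewrite p0 mul0r.
rewrite (IH j) ?mulr0 //; apply: (leq_trans _ (mk : (mdeg m <= k)%N)).
rewrite [X in (_ < X)%N](congr1 mdeg mE) mdegD.
by rewrite -addn1 addnC leq_add2r lt0n mdeg_eq0.
Qed.

Lemma mcoeff0M (K : comNzRingType) (p q : {mpoly K[h]}) :
  (p * q)@_0 = p@_0 * q@_0.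
Proof. exact: rmorphM. Qed.

(* Neumann series of [p = c (1 - r)]. *)
Lemma series_inv_exists (K : fieldType) (p : {mpoly K[h]}) : p@_0 != 0 ->
  exists f : mseries K h, smul (series_of_mpoly p) f = series_of_mpoly 1.
Proof.
move=> p0; pose r := 1 - (p@_0)^-1 *: p.
have r0 : r@_0 = 0 by rewrite mcoeffB mcoeff1 eqxx mcoeffZ mulVf ?subrr.
exists (fun m => (p@_0)^-1 * \sum_(k < (mdeg m).+1) (r ^+ k)@_m).
apply/funext => m.
set f := (f in smul _ f).
have fE : eq_upto (mdeg m) f ((p@_0)^-1 *: \sum_(k < (mdeg m).+1) r ^+ k).
  move=> k km; rewrite mcoeffZ raddf_sum /f /=; congr (_ * _).
  rewrite -!(big_mkord predT (fun i => (r ^+ i)@_k)).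
  rewrite (big_cat_nat (n := (mdeg k).+1) (p := (mdeg m).+1)) //=.
  rewrite [X in _ + X]big_nat_cond [X in _ + X]big1 ?addr0 // => i /andP[/andP[ki _] _].
  exact: mcoeff_expr_ord0.
rewrite (smul_upto (@mpoly_upto _ _ p) fE) // -scalerAr scalerAl.
have -> : (p@_0)^-1 *: p = 1 - r by rewrite /r; ring.
rewrite -opprB mulNr -subrX1 opprB /series_of_mpoly mcoeffB.
by rewrite (@mcoeff_expr_ord0 _ r) ?subr0.
Qed.
End SeriesProduct.

(** * Differential operators in s, evaluated at s = 0 *)

Section Evaluation.
Variables (C : fieldType) (h : nat) (q : {mpoly C[h]}).

Definition ev0 (V : lmodType C) (F : mseries V h) : V :=
  mpoly_act (@sderiv h V) q F 0%MM.

Lemma ev0E (V : lmodType C) (F : mseries V h) :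
  ev0 F = \sum_(m <- msupp q) q@_m *: multi_iter (@sderiv h V) m F 0%MM.
Proof. by rewrite /ev0 /mpoly_act fct_sumE. Qed.

Lemma ev0_is_linear (V : lmodType C) : linear (@ev0 V).
Proof.
move=> a F G; rewrite !ev0E scaler_sumr -big_split /=; apply: eq_bigr => m _.
have -> : multi_iter (@sderiv h V) m (a *: F + G) =
    a *: multi_iter (@sderiv h V) m F + multi_iter (@sderiv h V) m G.
  rewrite /multi_iter; elim: (enum _) => //= k l ->.
  elim: (m k) => //= i ->; apply/funext => x.
  by rewrite /sderiv /GRing.add /= mulrnDl /GRing.scale /= scalerMnr.
rewrite -[(_ + _) _]/(a *: multi_iter _ m F 0%MM + multi_iter _ m G 0%MM).
by rewrite scalerDr !scalerA mulrC.
Qed.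

HB.instance Definition _ (V : lmodType C) :=
  GRing.isLinear.Build C (mseries V h) V _ (@ev0 V) (@ev0_is_linear V).

Lemma ev0_comp (V W : lmodType C) (phi : {linear V -> W}) F :
  ev0 (fun m => phi (F m)) = phi (ev0 F).
Proof.
rewrite !ev0E linear_sum; apply: eq_bigr => m _; rewrite linearZ; congr (_ *: _).
rewrite -(@multi_iter_morph _ _ _ (fun G m => phi (G m)) (@sderiv h V)) //.
by move=> j G; apply/funext => k; rewrite /sderiv raddfMn.
Qed.

(** The constant term after applying [q] sees only coefficients in the degrees of [q], which
    [msize q] bounds. *)
Lemma ev0_eq (V : lmodType C) (F G : mseries V h) :
  (forall m, (mdeg m <= msize q)%N -> F m = G m) -> ev0 F = ev0 G.
Proof.
move=> FG; rewrite !ev0E; apply: eq_big_seq => m /msize_mdeg_lt mq; congr (_ *: _).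
(* Each derivative raises by one the degree of the coefficients that are read, so the bound [N] has
   to vary in the induction. *)
have key N l : (forall k, (mdeg k <= N + \sum_(j <- l) m j)%N -> F k = G k) ->
    forall k, (mdeg k <= N)%N ->
    foldr (fun j => iter (m j) (@sderiv h V j)) F l k =
    foldr (fun j => iter (m j) (@sderiv h V j)) G l k.
  elim: l N => [|j l IH] N /= FGN k kN.
    by apply: FGN; rewrite big_nil addn0.
  have {IH} := IH (N + m j)%N _; rewrite -addnA.
  have -> : (m j + \sum_(i <- l) m i = \sum_(i <- j :: l) m i)%N.
    by rewrite big_cons.
  move/(_ FGN); move: (foldr _ F l) (foldr _ G l) N k kN {FGN} => F' G'.
  elim: (m j) => [|i IH] N k kN FG'; first by apply: FG'; rewrite addn0.
  rewrite /= /sderiv; congr (_ *+ _); apply: (IH N.+1).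
    by rewrite mdegD mdeg1 addn1.
  by move=> k' k'N; apply: FG'; rewrite addnS -addSn.
rewrite /multi_iter (key 0%N) ?mdeg0 // => k km; apply: FG.
rewrite (leq_trans km) // add0n big_enum /= -mdegE; exact: ltnW.
Qed.

(** Links [ev0], which acts on series, to the pairing of polynomials in the definition of [perp]. *)
Lemma ev0_scale_mpoly (V : lmodType C) (x : V) (p : {mpoly C[h]}) :
  ev0 (fun m => p@_m *: x) = (mpoly_act (@mderiv h C) q p).@[fun=> 0] *: x.
Proof.
have meval0 (r : {mpoly C[h]}) : r.@[fun=> 0] = r@_0.
  rewrite mevalE {3}[r]mpolyE raddf_sum; apply: eq_bigr => m _ /=.
  rewrite mcoeffZ mcoeffX; congr (_ * _); have [->|m0] := eqVneq m 0%MM.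
    by rewrite big1 // => i _; rewrite mnm0E expr0.
  have /existsP[j mj] : [exists j, m j != 0%N].
    apply: contraR m0 => /existsPn mj; apply/eqP/mnmP => j.
    by have /negPn/eqP -> := mj j; rewrite mnm0E.
  by rewrite (bigD1 j) //= expr0n (negPf mj) mul0r.
rewrite meval0 ev0E /mpoly_act raddf_sum scaler_suml; apply: eq_bigr => m _.
rewrite /= mcoeffZ -scalerA; congr (_ *: _).
pose phi (r : {mpoly C[h]}) : mseries V h := fun k => r@_k *: x.
rewrite -[LHS]/(multi_iter (@sderiv h V) m (phi p) 0%MM).
rewrite -(@multi_iter_morph _ _ _ phi (@mderiv h C)) //.
by move=> j r; apply/funext => k; rewrite /phi /sderiv mcoeff_deriv scalerMnl.
Qed.

End Evaluation.

(** * Series constant in log x, and orthogonality to an ideal *)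

Section ConstantCoefficients.
Variables (C : fieldType) (n h : nat).

Definition const_series (S : mseries C h) : mseries {mpoly C[n]} h := fun m => (S m)%:MP.

Lemma const_series_smul f g :
  const_series (smul f g) = smul (const_series f) (const_series g).
Proof.
apply/funext => m; rewrite /const_series /smul rmorph_sum; apply: eq_bigr => k _.
by rewrite /= rmorphM.
Qed.

Lemma const_series_mpoly (p : {mpoly C[h]}) :
  const_series (series_of_mpoly p) = series_of_mpoly (map_mpoly (@mpolyC n C) p).
Proof.
by apply/funext => m; rewrite /const_series /series_of_mpoly mcoeff_map_mpoly.
Qed.

(** Only a truncation of [F] matters. The product then becomes a finite combination of the
    polynomials [p * 'X_[m]], with coefficients in C[log x], and [q] kills each of these polynomials
    at s = 0. *)
Lemma ev0_perp (P : set {mpoly C[h]}) q p (F : mseries {mpoly C[n]} h) :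
  (forall r, P (p * r)) -> perp P q ->
  ev0 q (smul (const_series (series_of_mpoly p)) F) = 0.
Proof.
move=> Pp qP; pose N := msize q.
have FE k : (mdeg k <= N)%N -> smul (const_series (series_of_mpoly p)) F k =
    \sum_(m : 'X_{1..h < N.+1}) (p * 'X_[m])@_k *: F m.
  move=> kN; rewrite const_series_mpoly.
  rewrite (smul_upto (@mpoly_upto _ _ N _) (@trunc_upto _ _ N F)) //.
  rewrite /trunc mulr_sumr raddf_sum; apply: eq_bigr => m _ /=.
  rewrite -scalerAr mcoeffZ -mul_mpolyC mulrC; congr (_ * _).
  by rewrite -(@mcoeff_map_mpoly _ _ _ (@mpolyC n C)) rmorphM /= map_mpolyX.
rewrite (@ev0_eq _ _ _ _ _ (\sum_(m : 'X_{1..h < N.+1})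
    ((fun k => (p * 'X_[m])@_k *: F m) : mseries {mpoly C[n]} h))); last first.
  by move=> m /FE ->; rewrite fct_sumE.
rewrite linear_sum big1 // => m _ /=.
by rewrite ev0_scale_mpoly (qP (p * 'X_[m])) ?scale0r.
Qed.

End ConstantCoefficients.

(** * The exponential series and its derivative *)

Section Exponential.
Variables (C : numFieldType) (n h : nat).

Lemma sexp_upto N (f : {mpoly {mpoly C[n]}[h]}) : f@_0 = 0 ->
  eq_upto N (sexp f) (\sum_(k < N.+1) (k`!%:R^-1 : C)%:MP *: f ^+ k).
Proof.
move=> f0 m mN; rewrite raddf_sum /sexp /=.
under [RHS]eq_bigr do rewrite mcoeffZ mul_mpolyC.
rewrite -!(big_mkord predT (fun k => (k`!%:R^-1 : C) *: (f ^+ k)@_m)).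
rewrite [RHS](big_cat_nat (n := (mdeg m).+1)) //=.
rewrite [X in _ + X]big_nat_cond [X in _ + X]big1 ?addr0 // => k /andP[/andP[mk _] _].
by rewrite mcoeff_expr_ord0 ?scaler0.
Qed.

Variable j : 'I_n.

Definition coeff_deriv (p p' : {mpoly {mpoly C[n]}[h]}) :=
  forall m, mderiv j p@_m = p'@_m.

Lemma coeff_derivX p p' k : coeff_deriv p p' ->
  coeff_deriv (p ^+ k.+1) (p' * p ^+ k *+ k.+1).
Proof.
move=> pp'; elim: k => [|k IH]; first by rewrite mulr1.
have -> : p' * p ^+ k.+1 *+ k.+2 = p' * p ^+ k.+1 + p * (p' * p ^+ k *+ k.+1).
  by rewrite mulrS mulrnAr exprS mulrCA.
move=> m; rewrite exprS mcoeffM raddf_sum mcoeffD !mcoeffM -big_split /=.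
by apply: eq_bigr => i _; rewrite mderivM pp' IH.
Qed.

(** The chain rule: the derivative of f^(k+1)/(k+1)! is f' f^k/k!. *)
Lemma sexp_deriv (f f' : {mpoly {mpoly C[n]}[h]}) :
  f@_0 = 0 -> f'@_0 = 0 -> coeff_deriv f f' ->
  (fun m => mderiv j (sexp f m)) = smul (series_of_mpoly f') (sexp f).
Proof.
move=> f0 f'0 ff'; apply/funext => m.
rewrite (smul_upto (@mpoly_upto _ _ _ _) (sexp_upto f0) (leqnn _)).
rewrite /sexp raddf_sum mulr_sumr raddf_sum /= big_ord_recl big_ord_recr /=.
rewrite mderivZ expr0 mcoeff1 (_ : mderiv j _ = 0) ?scaler0 ?add0r; last first.
  by case: eqP => _; rewrite ?mderiv0 // -[1]/(1%:MP) mderivC.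
(* The index shift leaves one extra term on the right, f' times the power of [f] of exponent
   [mdeg m]. Its order exceeds [mdeg m] because f' has no constant term. *)
rewrite [X in _ = _ + X](_ : _ = 0) ?addr0; last first.
  rewrite -scalerAr mcoeffZ mcoeffM big1 ?mulr0 // => -[a b] /= /eqP mE.
  have [->|a0] := eqVneq (val a) 0%MM; first by rewrite f'0 mul0r.
  rewrite (@mcoeff_expr_ord0 _ _ f) ?mulr0 //.
  rewrite [X in (_ < X)%N](congr1 mdeg mE) mdegD.
  by rewrite -addn1 addnC leq_add2r lt0n mdeg_eq0.
apply: eq_bigr => k _; rewrite mderivZ (coeff_derivX _ ff') -scalerAr mcoeffZ mul_mpolyC.
rewrite mcoeffMn -scaler_nat scalerA; congr (_ *: _).
by rewrite /bump /= add1n factS natrM invfM mulrAC mulVf ?mul1r // pnatr_eq0.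
Qed.

End Exponential.

(** * The factor x^(Bs) as a power series in s over C[log x] *)

Section LogSeries.
Variables (C : numFieldType) (n h : nat) (v : 'cV[C]_n) (B : 'M[int]_(n, h)).
Variable q : {mpoly C[h]}.

Lemma log_Bs_coeff0 : (log_Bs C B)@_0 = 0.
Proof.
rewrite raddf_sum big1 // => k _.
by rewrite /= mcoeffZ mcoeffX mnm1_eq0 mulr0.
Qed.

Lemma BsE j : Bs C B j 0 = \sum_k (B j k)%:~R *: 'X_k.
Proof.
rewrite mxE; apply: eq_bigr => k _; rewrite !mxE -mul_mpolyC; congr (_ * _).
by rewrite rmorph_int.
Qed.

Lemma Bs_coeff0 j : (Bs C B j 0)@_0 = 0.
Proof.
by rewrite BsE raddf_sum big1 // => k _; rewrite /= mcoeffZ mcoeffX mnm1_eq0 mulr0.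
Qed.

Lemma log_Bs_deriv j :
  coeff_deriv j (log_Bs C B) (map_mpoly (@mpolyC n C) (Bs C B j 0)).
Proof.
move=> m; rewrite mcoeff_map_mpoly BsE /log_Bs !raddf_sum /=.
apply: eq_bigr => k _ /=; rewrite !mcoeffZ mcoeffX.
rewrite [in RHS]mcoeffX; case: eqP => _; rewrite ?mulr0 ?mderiv0 ?mpolyC0 // !mulr1.
rewrite raddf_sum (bigD1 j) //= big1 ?addr0 => [|i ij].
  rewrite mderivZ mderivX mnm1E eqxx -{1}[U_(j)%MM]add0m addmK mpolyX0.
  by rewrite scale1r -mul_mpolyC mulr1.
by rewrite mderivZ mderivX mnm1E (negPf ij) scale0r scaler0.
Qed.

(** The series S(s) x^(Bs). *)
Definition texp (S : mseries C h) : mseries {mpoly C[n]} h :=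
  smul (const_series n S) (sexp (log_Bs C B)).

Lemma texp_smul f S : texp (smul f S) = smul (const_series n f) (texp S).
Proof. by rewrite /texp const_series_smul smulA. Qed.

Lemma texp0 : texp (fun=> 0) = 0.
Proof.
rewrite /texp (_ : const_series n _ = fun=> 0) ?smul0s //.
Qed.

Definition texp_mul S (p : {mpoly C[h]}) := texp (smul (series_of_mpoly p) S).

Lemma texp_mul_is_linear S : linear (texp_mul S).
Proof.
move=> a p p'; rewrite /texp_mul !texp_smul !const_series_mpoly rmorphD /=.
rewrite -mul_mpolyC rmorphM /=.
rewrite map_mpolyC mul_mpolyC; apply/funext => m.
by rewrite smul_linearl -[RHS]/(a *: smul _ _ m + smul _ _ m) -mul_mpolyC.
Qed.

HB.instance Definition _ S :=
  GRing.isLinear.Build C {mpoly C[h]} (mseries {mpoly C[n]} h) _ (texp_mul S)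
    (texp_mul_is_linear S).

(** Differentiating x^(Bs) with respect to log x_j brings down the factor (Bs)_j. *)
Lemma texp_deriv j S : (fun m => mderiv j (texp S m)) =
  texp (smul (series_of_mpoly (Bs C B j 0)) S).
Proof.
rewrite texp_smul /texp smulCA const_series_mpoly -(@sexp_deriv _ _ _ j) //; first last.
- exact: log_Bs_deriv.
- by rewrite mcoeff_map_mpoly Bs_coeff0 raddf0.
- exact: log_Bs_coeff0.
apply/funext => m; rewrite /smul raddf_sum; apply: eq_bigr => k _.
by rewrite /const_series /= mderiv_mulC.
Qed.
End LogSeries.

(** * Operators on logarithmic series *)

Section Represents.
Variables (C : numFieldType) (n h : nat) (v : 'cV[C]_n) (B : 'M[int]_(n, h)).
Variable q : {mpoly C[h]}.
Implicit Types (u : 'cV[int]_n) (S : 'cV[int]_n -> mseries C h).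

Local Notation intv := (map_mx intr).

(* [f] is [q(\partial_s)] applied to [\sum_u S_u(s) x^(v+Bs+u)], at [s = 0]. *)
Definition represents (f : logseries C n) S :=
  (forall u, f (v + intv u) = ev0 q (texp B (S u))) /\
  (forall gam, (forall u, gam <> v + intv u) -> f gam = 0).

Lemma represents_inj f f' S S' : represents f S -> represents f' S' ->
  (forall u, ev0 q (texp B (S u)) = ev0 q (texp B (S' u))) -> f = f'.
Proof.
move=> [fS f0] [fS' f0'] SS'; apply/funext => gam.
have [[u ->]|/forallNP nu] := pselect (exists u, gam = v + intv u).
  by rewrite fS SS' fS'.
by rewrite f0 ?f0'.
Qed.

Definition vBsu u j : {mpoly C[h]} := (vBs v B + intv u) j 0.

Lemma vBsuE u j : vBsu u j = ((v + intv u) j 0)%:MP + Bs C B j 0.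
Proof. by rewrite /vBsu /vBs !mxE mpolyCD rmorph_int addrAC. Qed.

Lemma vBsuD u u' j : vBsu (u + u') j = vBsu u j + (u' j 0)%:~R.
Proof. by rewrite /vBsu map_mxD addrA !mxE. Qed.

(** x_j \partial_j multiplies x^(v+Bs+u) by (v+Bs+u)_j: the constant part comes from the exponent of
    x, the part (Bs)_j from the logarithms. *)
Lemma represents_euler f S j u : represents f S ->
  (v + intv u) j 0 *: f (v + intv u) + mderiv j (f (v + intv u)) =
  ev0 q (texp B (smul (series_of_mpoly (vBsu u j)) (S u))).
Proof.
move=> [fS _]; rewrite fS -linearZ -ev0_comp /= -linearD texp_deriv; congr (ev0 q _).
rewrite vBsuE -alg_mpolyC -[RHS]/(texp_mul B (S u) _) linearP.
by rewrite /= /texp_mul smul1s.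
Qed.

Lemma represents_lsD f S j : represents f S ->
  represents (lsD j f) (fun u => let u' := u + delta_mx j 0 in
    smul (series_of_mpoly (vBsu u' j)) (S u')).
Proof.
move=> fS; split=> [u|gam gamN] /=.
  rewrite -(represents_euler _ _ fS) /lsD.
  have -> // : v + intv u + delta_mx j 0 = v + intv (u + delta_mx j 0).
  by rewrite map_mxD addrA map_delta_mx.
rewrite /lsD fS.2 ?scaler0 ?mderiv0 ?addr0 // => u /(canRL (addrK _)) gamE.
by apply: (gamN (u - delta_mx j 0)); rewrite map_mxB map_delta_mx addrA.
Qed.

Definition ffall (T : pzRingType) (y : T) (k : nat) : T := \prod_(i < k) (y - i%:R).

Lemma ffallS (T : comPzRingType) (y : T) k :
  ffall y k.+1 = ffall y k * (y - k%:R).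
Proof. by rewrite /ffall big_ord_recr. Qed.

Lemma represents_iter_lsD f S j k : represents f S ->
  represents (iter k (lsD j) f) (fun u => let u' := u + delta_mx j 0 *+ k in
    smul (series_of_mpoly (ffall (vBsu u' j) k)) (S u')).
Proof.
move=> fS; elim: k => [|k IH] /=.
  split=> [u|gam gamN]; last by rewrite fS.2.
  by rewrite fS.1 mulr0n addr0 /ffall big_ord0 smul1s.
move/(represents_lsD j): IH; congr represents; apply/funext => u /=.
rewrite ffallS smulA -smulM [_ * ffall _ _]mulrC -addrA -mulrS.
congr (smul (series_of_mpoly (_ * _)) _).
rewrite !vBsuD mxE !eqxx mulmxnE mxE !eqxx -[k.+1]addn1 mulrnDr mulr1n rmorphD /=.
by rewrite rmorphMn /= !rmorph1; ring.
Qed.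

(** \partial^a lowers exponents by [a], so the term at [u] comes from the one at u + a and carries
    the factor [v+Bs+u+a]_a. *)
Lemma represents_multi_iter_lsD f S (a : 'X_{1..n}) : represents f S ->
  represents (multi_iter (@lsD C n) a f) (fun u => let u' := u + colv a in
    smul (series_of_mpoly (descfact (vBs v B + intv u') a)) (S u')).
Proof.
move=> fS; pose dl l : 'cV[int]_n := \sum_(j <- l) delta_mx j 0 *+ a j.
have key l : uniq l ->
    represents (foldr (fun j => iter (a j) (@lsD C n j)) f l) (fun u =>
      let u' := u + dl l in
      smul (series_of_mpoly (\prod_(j <- l) ffall (vBsu u' j) (a j))) (S u')).
  elim: l => [|j l IH] /=.
    split=> [u|gam gamN]; last by rewrite fS.2.
    by rewrite fS.1 /dl !big_nil addr0 smul1s.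
  move=> /andP[jl /IH /(represents_iter_lsD j (a j))]; congr represents.
  apply/funext => u /=; rewrite /dl !big_cons smulA -smulM addrA.
  congr (smul (series_of_mpoly (_ * _)) _); congr ffall.
  rewrite !vBsuD summxE mulmxnE mxE !eqxx big1_seq ?addr0 // => i /andP[_ il].
  by rewrite mulmxnE mxE eq_sym (negPf (memPn jl _ il)) mul0rn.
have dlE : dl (enum 'I_n) = colv a.
  apply/matrixP => i k; rewrite ord1 /dl big_enum summxE mxE (bigD1 i) //=.
  rewrite big1 ?addr0 => [|j ji]; rewrite mulmxnE mxE ?eqxx /=.
    exact: natz.
  by rewrite eq_sym (negPf ji) mul0rn.
move/(_ (enum 'I_n) (enum_uniq _)): key; congr represents.
by apply/funext => u /=; rewrite dlE big_enum.
Qed.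
End Represents.

(** * Vanishing orders of the coefficients *)

Section FallingFactorial.

Lemma ffallD (T : comPzRingType) (y : T) m k :
  ffall y (m + k) = ffall y m * ffall (y - m%:R) k.
Proof.
rewrite /ffall big_split_ord; congr (_ * _); apply: eq_bigr => i _ /=.
by rewrite natrD opprD addrA.
Qed.

(* Both sides are [Gamma(y+1) / Gamma(y+w+1)] times the two denominators, with
   [w = u - a = u' - b]. *)
Lemma ffall_cross (T : comPzRingType) (y : T) (u u' : int) (a b : nat) :
  u - a%:Z = u' - b%:Z ->
  ffall (y + u%:~R) a * ffall y (absz (Num.max (- u) 0)%R) *
    ffall (y + u'%:~R) (absz (Num.max u' 0)%R) =
  ffall (y + u'%:~R) b * ffall y (absz (Num.max (- u') 0)%R) *
    ffall (y + u%:~R) (absz (Num.max u 0)%R).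
Proof.
(* The sign of w decides the form of the common value. For w nonnegative, the numerator products are
   empty and the denominator splits after its first [c] factors. *)
have nonneg (x : int) (c w : nat) : x = w%:Z + c%:Z ->
    ffall y (absz (Num.max (- x) 0)%R) = 1 /\
    ffall (y + x%:~R) (absz (Num.max x 0)%R) =
      ffall (y + x%:~R) c * ffall (y + w%:R) w.
  move=> ->; have -> : (absz (Num.max (- (w%:Z + c%:Z)) 0)%R) = 0%N by lia.
  have -> : (absz (Num.max (w%:Z + c%:Z) 0)%R) = (c + w)%N by lia.
  split; first by rewrite /ffall big_ord0.
  by rewrite ffallD rmorphD /= addrA addrK.
(* Here the common shift is -w; the longer of the two products splits according to whether [c]
   exceeds [w]. *)
have neg (x : int) (c w : nat) : x = c%:Z - w%:Z ->
    ffall (y + x%:~R) c * ffall y (absz (Num.max (- x) 0)%R) =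
    ffall y w * ffall (y + x%:~R) (absz (Num.max x 0)%R).
  move=> ->; have [cw|/ltnW wc] := leqP c w.
    have -> : (absz (Num.max (- (c%:Z - w%:Z)) 0)%R) = (w - c)%N by lia.
    have -> : (absz (Num.max (c%:Z - w%:Z) 0)%R) = 0%N by lia.
    rewrite -{3}(subnK cw) ffallD mulrAC [ffall _ 0]big_ord0 mulr1 mulrC.
    by congr (_ * ffall _ _); rewrite rmorphB /= natrB // opprB.
  have -> : (absz (Num.max (- (c%:Z - w%:Z)) 0)%R) = 0%N by lia.
  have -> : (absz (Num.max (c%:Z - w%:Z) 0)%R) = (c - w)%N by lia.
  rewrite -{2}(subnK wc) ffallD [ffall y 0]big_ord0 mulr1 mulrC.
  by congr (ffall _ _ * _); rewrite rmorphB /= natrB //; ring.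
move=> uu'; case uaE : (u - a%:Z) => [w|w].
  have [|-> ->] := nonneg u a w; first by lia.
  have [|-> ->] := nonneg u' b w; first by lia.
  ring.
by rewrite (neg u a w.+1) ?(neg u' b w.+1); first ring; lia.
Qed.

Variables (C : numFieldType) (h : nat) (c : C) (l : {mpoly C[h]}).

Lemma ffall_dvd (i k : nat) : c = i%:R -> (i < k)%N ->
  exists r, ffall (c%:MP + l) k = l * r.
Proof.
move=> ci ik; rewrite /ffall (bigD1 (Ordinal ik)) //= ci mpolyC_nat addrC addKr.
by eexists.
Qed.

Hypothesis l0 : l@_0 = 0.

Lemma ffall_unit k : (forall i, (i < k)%N -> c != i%:R) ->
  (ffall (c%:MP + l) k)@_0 != 0.
Proof.
move=> ck; rewrite /ffall rmorph_prod; apply/prodf_neq0 => i _.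
rewrite /= mcoeffB mcoeffD l0 addr0 -mpolyC_nat !mcoeffC eqxx !mulr1.
by rewrite subr_eq0 ck.
Qed.

(** Only the factor of index [i] vanishes at s = 0; the others take the values i - t with t
    different from i, nonzero in characteristic 0. *)
Lemma ffall_dvd_unit i k : c = i%:R -> (i < k)%N ->
  exists2 r, ffall (c%:MP + l) k = l * r & r@_0 != 0.
Proof.
move=> ci ik; rewrite /ffall (bigD1 (Ordinal ik)) //= ci mpolyC_nat addrC addKr.
eexists; first by [].
rewrite rmorph_prod; apply/prodf_neq0 => t ti.
rewrite /= mcoeffB mcoeffD l0 ?addr0 ?add0r -!mpolyC_nat !mcoeffC eqxx.
by rewrite !mulr1 subr_eq0 eqr_nat eq_sym.
Qed.

End FallingFactorial.

(** The fraction may have been expanded from another representation P'/Q'. Cross-multiplication,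
    then cancellation of Q', carries the identity over to P/Q; the given [g] shows that an expansion
    exists. *)
Lemma series_of_fracP (C : fieldType) h (P Q : {mpoly C[h]}) g :
  Q != 0 -> smul (series_of_mpoly Q) g = series_of_mpoly P ->
  smul (series_of_mpoly Q) (series_of_frac (tofrac P / tofrac Q)) =
  series_of_mpoly P.
Proof.
move=> Q0 Qg; rewrite /series_of_frac; case: xgetP => [f _ [P' [Q' [Q'0 PQ Q'f]]]|noex].
  apply: (smulrI Q'0); rewrite smulCA Q'f -!smulM; congr series_of_mpoly.
  apply/eqP; rewrite -tofrac_eq !tofracM mulrC (mulrC (tofrac Q')).
  by rewrite -eqr_div ?tofrac_eq0 // PQ.
by case: (noex g); exists P, Q.
Qed.

Section Core.
Variables (C : numFieldType) (d n h M : nat).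
Variables (A : 'M[int]_(d, n)) (v : 'cV[C]_n) (B : 'M[int]_(n, h)).
Variable g : 'I_M -> 'cV[int]_n.
Hypothesis suppB : forall u, lattice A u ->
  I_ v 0 \subset (supp_mx B :|: I_ v u)%SET.
Implicit Types (u : 'cV[int]_n) (a b : 'X_{1..n}).

Local Notation intv := (map_mx intr).
Local Notation K := (K_N A v B g).

Lemma mem_I u j : reflect (exists2 z : int, v j 0 = z%:~R & z + u j 0 < 0) (j \in I_ v u).
Proof.
rewrite inE !mxE; apply: (iffP (asboolP _)) => [[k vk]|[z -> zu]].
  exists (- k.+1%:Z - u j 0); last by lia.
  by rewrite rmorphB rmorphN /= -vk addrK.
case zuE : (z + u j 0) zu => [//|k] _; exists k.
by rewrite -rmorphD /= zuE NegzE rmorphN.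
Qed.

Lemma mem_I_int u j (z : int) : v j 0 = z%:~R -> (j \in I_ v u) = (z + u j 0 < 0).
Proof.
move=> vz; apply/mem_I/idP => [[z']|]; last by exists z.
by rewrite vz => /intr_inj <-.
Qed.

Lemma v_int u j (z : int) : v j 0 = z%:~R -> (v + intv u) j 0 = (z + u j 0)%:~R.
Proof. by rewrite !mxE => ->; rewrite rmorphD. Qed.

Lemma vBsu0 j : vBsu v B 0 j = vBs v B j 0.
Proof. by rewrite /vBsu map_mx0 addr0. Qed.

Lemma Bs_neq0 j : j \in supp_mx B -> Bs C B j 0 != 0.
Proof.
rewrite inE => /rV0Pn[k]; rewrite mxE => Bjk; apply/eqP => /(congr1 (mcoeff U_(k)%MM)).
rewrite BsE raddf_sum mcoeff0 (bigD1 k) //= big1 ?addr0 => [|i ik].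
  by rewrite mcoeffZ mcoeffX eqxx mulr1 => /eqP; rewrite intr_eq0 (negPf Bjk).
by rewrite mcoeffZ mcoeffX eq_mnm1 (negPf ik) mulr0.
Qed.

Lemma Bs_eq0 j : j \notin supp_mx B -> Bs C B j 0 = 0.
Proof.
rewrite inE negbK => /eqP /rowP Bj; rewrite BsE big1 // => k _.
by have := Bj k; rewrite !mxE => ->; rewrite scale0r.
Qed.

(** Turns a product over [J] into one over all coordinates, so that divisibility can be checked for
    each [j] separately. *)
Definition Bs_if (J : {set 'I_n}) j : {mpoly C[h]} :=
  if j \in J then Bs C B j 0 else 1.

Lemma Bs_prodE J : Bs_prod C B J = \prod_j Bs_if J j.
Proof. by rewrite /Bs_prod big_mkcond. Qed.

Local Notation den u := (descfact (vBs v B + intv u) (posv u)).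
Local Notation num u := (descfact (vBs v B) (negv u)).

(** For j in I_0 but not in I_u, the factors of the denominator pass through zero exactly once, and
    for other j never. The cofactor [U] is thus invertible as a power series. *)
Lemma den_factor u : exists2 U : {mpoly C[h]},
  den u = Bs_prod C B (I_ v 0 :\: I_ v u)%SET * U & U@_0 != 0.
Proof.
rewrite Bs_prodE.
suff key j : exists2 U : {mpoly C[h]},
    ffall (vBsu v B u j) (posv u j) = Bs_if (I_ v 0 :\: I_ v u)%SET j * U & U@_0 != 0.
  rewrite -[descfact _ _]/(\prod_j ffall (vBsu v B u j) (posv u j)).
  elim/big_rec2: _ => [|j y x _ [U -> U0]].
    by exists 1; rewrite ?mulr1 // mcoeff1 eqxx oner_neq0.
  by have [V -> V0] := key j; exists (V * U); [ring | rewrite mcoeff0M mulf_neq0].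
rewrite vBsuE /Bs_if mnmE inE; have [|jI] := ifPn.
  case/andP => ju /mem_I[z vz]; rewrite mxE addr0 => z0.
  move: ju; rewrite (mem_I_int _ vz) -leNgt => zu.
  case zuE : (z + u j 0) (zu) => [i|//] _.
  apply: (@ffall_dvd_unit _ _ _ _ (Bs_coeff0 _ _ _) i);
    rewrite ?(v_int _ vz) ?zuE //; lia.
eexists; first by rewrite mul1r.
apply: ffall_unit => [|i iu]; first exact: Bs_coeff0.
(* A vanishing factor gives v_j + u_j = i with 0 <= i < u_j, hence v_j < 0 <= v_j + u_j, which puts
   j in I_0 but not in I_u. *)
apply: contraNneq jI => vi.
have vz : v j 0 = (i%:Z - u j 0)%:~R.
  by move: vi; rewrite !mxE rmorphB /= => /(canRL (addrK _)) ->.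
by rewrite !(mem_I_int _ vz) mxE; lia.
Qed.

Lemma Bs_dvd_num u j : j \in I_ v u -> j \notin I_ v 0 ->
  exists r, ffall (vBs v B j 0) (negv u j) = Bs C B j 0 * r.
Proof.
move=> /mem_I[z vz zu]; rewrite (mem_I_int _ vz) -leNgt mxE addr0 => z0.
rewrite -vBsu0 vBsuE; case: z vz zu z0 => // i vz zu _.
apply: (@ffall_dvd _ _ _ _ i); rewrite ?(v_int _ vz) ?mnmE ?mxE ?addr0 //.
have lt_neg (x : int) : i%:Z + x < 0 -> (i < absz (Num.max (- x) 0)%R)%N by lia.
exact: lt_neg.
Qed.

(** Here v_j + u_j >= 0, whereas v_j + u_j - a_j = v_j + u'_j - b_j < 0, so the descending product
    meets zero. *)
Lemma Bs_dvd_desc u u' a b j : u - colv a = u' - colv b ->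
  j \in I_ v u' -> j \notin I_ v u ->
  exists r, ffall (vBsu v B u j) (a j) = Bs C B j 0 * r.
Proof.
move=> uu'; have ab : u j 0 - (a j)%:Z = u' j 0 - (b j)%:Z.
  by move/matrixP/(_ j 0): uu'; rewrite !mxE.
move=> /mem_I[z vz zu']; rewrite (mem_I_int _ vz) -leNgt => zu.
case zuE : (z + u j 0) (zu) => [i|//] _; rewrite vBsuE.
by apply: (@ffall_dvd _ _ _ _ i); rewrite ?(v_int _ vz) ?zuE //; lia.
Qed.

(** Since K_N lies in I_u, m(s) supplies the indices of I_0 outside I_u and those of I_0 and I_u
    outside K_N. The numerator of a_u supplies I_u minus I_0, and [v+Bs+u]_a supplies I_u' minus
    I_u. *)
Lemma num_factor u u' a b : I_ v u \in calN A v B g -> u - colv a = u' - colv b ->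
  exists R, m_s A v B g * (descfact (vBs v B + intv u) a * num u) =
    Bs_prod C B (I_ v 0 :\: I_ v u)%SET *
    (Bs_prod C B ((I_ v u :|: I_ v u') :\: K)%SET * R).
Proof.
move=> uN ab; rewrite /m_s !Bs_prodE.
have Ku : K \subset I_ v u by apply: (@finset.bigcap_inf _ _ (I_ v u)).
suff key j : exists r, Bs_if (I_ v 0 :\: K)%SET j *
    (ffall (vBsu v B u j) (a j) * ffall (vBs v B j 0) (negv u j)) =
    Bs_if (I_ v 0 :\: I_ v u)%SET j *
    (Bs_if ((I_ v u :|: I_ v u') :\: K)%SET j * r).
  have [r rE] := boolp.choice key.
  exists (\prod_j r j); rewrite -!big_split /=; exact: eq_bigr.
rewrite /Bs_if !finset.in_setD !finset.in_setU; have := fintype.subsetP Ku j.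
have dn := @Bs_dvd_num u j; have dd := @Bs_dvd_desc u u' a b j ab.
move: (ffall (vBsu _ _ _ _) _) (ffall (vBs _ _ _ _) _) dn dd => x y dn dd.
(* An index of K_N lies in I_u, so it occurs in none of the three monomials. *)
case: (j \in K) => [/(_ isT) -> /=|_]; first by exists (x * y); rewrite !mul1r.
case: (j \in I_ v u) dn dd => dn dd; case: (j \in I_ v 0) dn => dn /=.
- by exists (x * y); ring.
- by have [//|//|r ->] := dn; exists (x * r); ring.
- case: (j \in I_ v u') dd => dd; last by exists (x * y); ring.
  by have [//|//|r ->] := dd; exists (r * y); ring.
- case: (j \in I_ v u') dd => dd; last by exists (x * y); ring.
  by have [//|//|r ->] := dd; exists (r * y); ring.
Qed.

(** Extending by zero outside L' allows the series to be indexed by all integer vectors. *)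
Definition frob_coeff u : mseries C h := if `[< L' A v B g u >]
  then series_of_frac (tofrac (m_s A v B g) * a_ v B u) else fun=> 0.

Lemma Bs_prod_neq0 u : lattice A u -> Bs_prod C B (I_ v 0 :\: I_ v u)%SET != 0.
Proof.
move=> uL; apply/prodf_neq0 => j; rewrite finset.in_setD => /andP[ju j0].
apply: Bs_neq0; have := fintype.subsetP (suppB uL) j j0.
by rewrite finset.in_setU (negPf ju) orbF.
Qed.

Lemma den_neq0 u : lattice A u -> den u != 0.
Proof.
move=> uL; have [U -> U0] := den_factor u.
rewrite mulf_neq0 ?Bs_prod_neq0 //; apply: contraNneq U0 => ->.
by rewrite mcoeff0.
Qed.

Lemma descfact0 (x : 'cV[{mpoly C[h]}]_n) : descfact x 0%MM = 1.
Proof. by rewrite /descfact big1 // => j _; rewrite mnm0E big_ord0. Qed.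

Lemma den_frob_coeff u : L' A v B g u ->
  smul (series_of_mpoly (den u)) (frob_coeff u) = series_of_mpoly (m_s A v B g * num u).
Proof.
move=> uL'; have [uL uN] := uL'; rewrite /frob_coeff (asboolT uL') /a_ mulrA -tofracM.
have [U denE U0] := den_factor u; have [V UV] := series_inv_exists U0.
(* With a = b = 0 and u' = u, the vanishing part of the denominator divides m(s) times the
   numerator. Inverting the remaining unit [U] gives the power series needed. *)
have [R0] := @num_factor u u 0%MM 0%MM uN erefl; rewrite descfact0 mul1r => ->.
set X := _ * R0; apply: (@series_of_fracP _ _ _ _ (smul (series_of_mpoly X) V)).
  exact: den_neq0.
rewrite denE !smulM -smulA (smulCA _ _ V) UV.
by rewrite [smul _ (series_of_mpoly 1)]smulC smul1s.
Qed.

(** * Cancellation under the binomial operators *)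

Variable q : {mpoly C[h]}.
Hypothesis perp_q : perp (P_N A v B g) q.

(** After cancelling the denominator, the coefficient is a power series multiple of the monomial of
    (I_u \cup I_u') \ K_N, which is either a generator of P_N or zero. *)
Lemma frob_coeff_boundary u u' a b : L' A v B g u -> lattice A u' -> ~ L' A v B g u' ->
  u - colv a = u' - colv b ->
  ev0 q (texp B (smul (series_of_mpoly (descfact (vBs v B + intv u) a))
    (frob_coeff u))) = 0.
Proof.
move=> uL' u'L nu'L' ab; have [uL uN] := uL'.
have [U denE U0] := den_factor u; have [V UV] := series_inv_exists U0.
have [R0 numE] := num_factor uN ab.
set D := descfact _ a in numE *; set X := Bs_prod C B ((_ :|: _) :\: K)%SET in numE.
have -> : smul (series_of_mpoly D) (frob_coeff u) =
    smul (series_of_mpoly X) (smul (series_of_mpoly R0) V).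
  apply: (smulrI (den_neq0 uL)); rewrite smulCA den_frob_coeff // -smulM mulrCA numE denE.
  rewrite !smulM -!smulA; congr (smul _ _); rewrite smulCA; congr (smul _ _).
  by rewrite smulCA UV smulC smul1s.
rewrite texp_smul; apply: (@ev0_perp C n h (P_N A v B g) q X _ _ perp_q) => r.
have u'N : I_ v u' \notin calN A v B g by apply/negP => u'N; apply: nu'L'.
have [suppE|suppN] := eqVneq (supp_mx B :|: I_ v u')%SET (supp_mx B :|: I_ v 0)%SET.
  exists 1%N, (fun=> r), (fun=> X); split; last by rewrite big_ord1 mulrC.
  move=> _; exists (I_ v u), (I_ v u'); split=> //.
  by rewrite finset.in_setD u'N inE; apply/asboolP; exists u'.
suff -> : X = 0.
  by exists 0%N, (fun=> 0), (fun=> 0); split=> [[]//|]; rewrite big_ord0 mul0r.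
(* The hypothesis on B gives one inclusion, so the equality fails through some j in I_u' outside
   supp(B) and I_0. As I_u is in N, this j is not in I_u, hence not in K_N, and its factor (Bs)_j =
   0 occurs in [X]. *)
have /fintype.subsetPn[j] :
    ~~ ((supp_mx B :|: I_ v u') \subset (supp_mx B :|: I_ v 0))%SET.
  apply: contraNN suppN => sub; rewrite finset.eqEsubset sub.
  by rewrite finset.subUset finset.subsetUl suppB.
rewrite !finset.in_setU negb_or => jB' /andP[jB j0].
have ju' : j \in I_ v u' by move: jB'; rewrite (negPf jB).
have ju : j \notin I_ v u.
  case/finset.setIdP: uN => _ /eqP/setP/(_ j).
  by rewrite !finset.in_setU (negPf jB) (negPf j0) /= => ->.
have jK : j \notin K.
  apply: contraNN ju; apply/fintype.subsetP.
  by apply: (@finset.bigcap_inf _ _ (I_ v u)).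
have jX : j \in ((I_ v u :|: I_ v u') :\: K)%SET.
  by rewrite finset.in_setD finset.in_setU jK ju' orbT.
by rewrite /X /Bs_prod (bigD1 j jX) /= Bs_eq0 // mul0r.
Qed.

Lemma descfact_cross u u' a b : u - colv a = u' - colv b ->
  descfact (vBs v B + intv u) a * num u * den u' =
  descfact (vBs v B + intv u') b * num u' * den u.
Proof.
have descE (x : 'cV[{mpoly C[h]}]_n) m : descfact x m = \prod_j ffall (x j 0) (m j) by [].
move=> uu'; rewrite !descE -!big_split /=; apply: eq_bigr => j _.
have ab : u j 0 - (a j)%:Z = u' j 0 - (b j)%:Z.
  by move/matrixP/(_ j 0): uu'; rewrite !mxE.
have vBsE x : (vBs v B + intv x) j 0 = vBs v B j 0 + (x j 0)%:~R.
  by rewrite [LHS]mxE [in X in _ + X]mxE.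
have posvE x : posv x j = absz (Num.max (x j 0) 0)%R by rewrite mnmE.
have negvE x : negv x j = absz (Num.max (- x j 0) 0)%R by rewrite posvE mxE.
by rewrite !vBsE !negvE !posvE (ffall_cross _ ab).
Qed.

(** In characteristic 0, v + u determines u, so the sum defining each coefficient has at most one
    term. *)
Lemma represents_Ftilde : represents v B q (Ftilde_at0 A v B g q) frob_coeff.
Proof.
have v_inj : injective (fun u => v + intv u).
  move=> u u' /addrI /matrixP uu'; apply/matrixP => i j.
  by have := uu' i j; rewrite !mxE => /intr_inj.
split=> [u|gam gamN]; last first.
  rewrite /Ftilde_at0 (_ : [set u | _] = set0) ?fsbig_set0 //.
  by apply/seteqP; split=> // u [_ /esym]; exact: gamN.
rewrite /Ftilde_at0 /frob_coeff; case: asboolP => uL'.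
  rewrite (_ : [set u' | _] = [set u]) ?fsbig_set1 //.
  by apply/seteqP; split=> [u' [_ /v_inj]|u' ->].
rewrite (_ : [set u' | _] = set0) ?fsbig_set0 ?texp0 ?linear0 //.
by apply/seteqP; split=> // u' [u'L' /v_inj uu']; apply: uL'; rewrite -uu'.
Qed.

Lemma Ftilde_binomial a b : A *m colv a = A *m colv b ->
  multi_iter (@lsD C n) a (Ftilde_at0 A v B g q) =
  multi_iter (@lsD C n) b (Ftilde_at0 A v B g q).
Proof.
move=> Aab; have rep c := represents_multi_iter_lsD c represents_Ftilde.
apply: (represents_inj (rep a) (rep b)) => w /=.
set u := w + colv a; set u' := w + colv b.
have uu' : u - colv a = u' - colv b by rewrite !addrK.
have latE : lattice A u <-> lattice A u' by rewrite /lattice /= /u /u' !mulmxDr Aab.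
have frob_coeff0 x : ~ L' A v B g x -> frob_coeff x = fun=> 0.
  by rewrite /frob_coeff => /asboolF ->.
have [uL'|uL'] := pselect (L' A v B g u); have [u'L'|u'L'] := pselect (L' A v B g u').
- congr (ev0 q (texp B _)).
  (* Multiplying by both denominators reduces the equality to the cross relation times m(s). *)
  apply: (smulrI (den_neq0 uL'.1)); apply: (smulrI (den_neq0 u'L'.1)).
  rewrite (smulCA _ _ (frob_coeff u)) den_frob_coeff // -!smulM.
  rewrite [in RHS]smulA -[in RHS]smulM -[in RHS]mulrC [in RHS]smulM -[in RHS]smulA.
  rewrite [in RHS](smulCA _ _ (frob_coeff u')) den_frob_coeff // -!smulM.
  congr series_of_mpoly.
  have := descfact_cross uu'; move: (descfact _ a) (descfact _ b) => da db E.
  transitivity (m_s A v B g * (da * num u * den u')); first by ring.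
  by rewrite E; ring.
(* Only one side has a term here; orthogonality to P_N kills it. *)
- rewrite (frob_coeff_boundary uL' _ u'L' uu'); last by apply/latE; case: uL'.
  by rewrite frob_coeff0 // smuls0 texp0 linear0.
- rewrite [RHS](frob_coeff_boundary u'L' _ uL' (esym uu'));
    last by apply/latE; case: u'L'.
  by rewrite frob_coeff0 // smuls0 texp0 linear0.
- by rewrite !frob_coeff0 // !smuls0.
Qed.

End Core.

(** * From generators to the hypergeometric ideal *)

Section Solution.
Variables (C : numFieldType) (d n : nat) (A : 'M[int]_(d, n)) (beta : 'cV[C]_d).

(** A monomial multiple of a binomial with A a = A b is again such a binomial; linearity does the
    rest. *)
Lemma toric_ideal_act (f : logseries C n) :
  (forall a b, A *m colv a = A *m colv b ->
     multi_iter (@lsD C n) a f = multi_iter (@lsD C n) b f) ->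
  forall p, toric_ideal A p -> mpoly_act (@lsD C n) p f = 0.
Proof.
move=> fab p [k [c [x [xE ->]]]].
rewrite -[LHS]/(mpoly_act_on _ f _) linear_sum big1 // => i _ /=.
have [a [b [Aab ->]]] := xE i.
rewrite (mpolyE (c i)) mulr_suml linear_sum big1 // => m _ /=.
rewrite -scalerAl linearZ mulrBr linearB /= -!mpolyXD !mpoly_actX.
rewrite (fab (m + a)%MM (m + b)%MM) ?subrr ?scaler0 //.
have colvD (e e' : 'X_{1..n}) : colv (e + e')%MM = colv e + colv e'.
  by apply/matrixP => r t; rewrite !mxE mnmDE PoszD.
by rewrite !colvD !mulmxDr Aab.
Qed.

Lemma weyl0 P : weyl P -> P (0 : logseries C n) = 0.
Proof.
elim=> [c|j|j|P1 P2 _ IH1 _ IH2|P1 P2 _ IH1 _ IH2]; apply/funext => gam.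
- by rewrite scaler0.
- by [].
- by rewrite /lsD -[(0 : logseries C n) _]/(0 : {mpoly C[n]}) scaler0 mderiv0 addr0.
- by rewrite IH1 IH2 addr0.
- by rewrite IH2 IH1.
Qed.

Lemma is_solution_generators (f : logseries C n) :
  (forall a b, A *m colv a = A *m colv b ->
     multi_iter (@lsD C n) a f = multi_iter (@lsD C n) b f) ->
  (forall i, euler_op A beta i f = 0) -> is_solution A beta f.
Proof.
move=> fab fE T [k [P [G [PG ->]]]]; apply: big1 => i _.
have [Pi [[p pI ->]|[j _ <-]]] := PG i.
  by rewrite toric_ideal_act // weyl0.
by rewrite fE weyl0.
Qed.

(** On the term at u in L, the operator acts by row i of A (v+Bs+u) - beta, which is zero because A
    v = beta, A B = 0 and A u = 0. *)
Lemma euler_represents h v (B : 'M[int]_(n, h)) q f S i :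
  map_mx intr A *m v = beta -> (forall k, lattice A (col k B)) ->
  represents v B q f S -> (forall u, ~ lattice A u -> S u = fun=> 0) ->
  euler_op A beta i f = 0.
Proof.
move=> Av BL fS S0; apply/funext => gam.
rewrite -[RHS]/(0 : {mpoly C[n]}) /euler_op.
have -> : (\sum_j (A i j)%:~R *: lsX j (lsD j f) - beta i 0 *: f) gam =
    \sum_j (A i j)%:~R *: (gam j 0 *: f gam + mderiv j (f gam)) - beta i 0 *: f gam.
  rewrite -[LHS]/((\sum_j (A i j)%:~R *: lsX j (lsD j f)) gam - beta i 0 *: f gam).
  rewrite fct_sumE; congr (_ - _); apply: eq_bigr => j _.
  by rewrite -[LHS]/(_ *: lsX j (lsD j f) gam) /lsX /lsD subrK.
have [[u ->]|/forallNP nu] := pselect (exists u, gam = v + map_mx intr u); last first.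
  rewrite fS.2 // big1 ?scaler0 ?subrr // => j _.
  by rewrite scaler0 mderiv0 addr0 scaler0.
under eq_bigr do rewrite (represents_euler _ _ fS).
rewrite fS.1; have [uL|/S0 ->] := pselect (lattice A u); last first.
  rewrite texp0 linear0 scaler0 subr0 big1 // => j _.
  by rewrite smuls0 texp0 linear0 scaler0.
(* Written with the factor 1, all terms are images of polynomials under one linear map, so the
   scalar identity can be applied inside it. *)
have <- : texp_mul B (S u) 1 = texp B (S u) by rewrite /texp_mul smul1s.
under eq_bigr do rewrite -[texp _ _]/(texp_mul B (S u) _) -2!linearZ.
have ABs : map_mx intr A *m (vBs v B + map_mx intr u) = map_mx (@mpolyC h C) beta.
  rewrite /vBs !mulmxDr /Bs mulmxA -!map_mxM uL.
  have -> : A *m B = 0.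
    apply/matrixP => r t; have /matrixP/(_ r 0) := BL t; rewrite !mxE => E.
    by rewrite -[RHS]E; apply: eq_bigr => k _; rewrite mxE.
  rewrite !map_mx0 mul0mx !addr0 -Av map_mxM -map_mx_comp; congr (_ *m _).
  by apply/matrixP => r t; rewrite !mxE /= rmorph_int.
have euler_sum : \sum_j (A i j)%:~R *: vBsu v B u j - beta i 0 *: 1 = 0.
  have /matrixP/(_ i 0) := ABs; rewrite [LHS]mxE [RHS]mxE => ABs_i.
  apply/eqP; rewrite subr_eq0 alg_mpolyC -ABs_i; apply/eqP/eq_bigr => j _.
  by rewrite mxE -mul_mpolyC rmorph_int.
by rewrite -2!linearZ -2!linear_sum -2!linearB euler_sum !linear0.
Qed.

End Solution.

Theorem theorem2p7 (R : realType) (d n h M : nat)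
    (A : 'M[int]_(d, n)) (beta : 'cV[R[i]]_d) (w : 'cV[R]_n)
    (v : 'cV[R[i]]_n) (B : 'M[int]_(n, h)) (g : 'I_M -> 'cV[int]_n)
    (rankA : \rank (map_mx intr A : 'M[rat]_(d, n)) = d)
    (homA : homogeneous_mx A)
    (generic_w :
       monomial_ideal (in_ideal w (toric_ideal A : set {mpoly R[i][n]})))
    (fake_v : fake_exponent A v beta w)
    (BL : forall k, lattice A (col k B))
    (freeB : \rank (map_mx intr B : 'M[rat]_(n, h)) = h)
    (suppB : forall u, lattice A u ->
       I_ v 0 \subset (supp_mx B :|: I_ v u)%SET)
    (groebner_g : reduced_groebner w (toric_ideal A)
       (range (fun i => box R[i] (g i))))
    (lead_g : forall i,
       in_ideal w (toric_ideal A) ('X_[posv (g i)] : {mpoly R[i][n]}))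
    (q : {mpoly R[i][h]}) :
  perp (P_N A v B g) q -> is_solution A beta (Ftilde_at0 A v B g q).
Proof.
move=> perp_q; have [Av _] := fake_v.
have repF := represents_Ftilde A v B g q.
apply: is_solution_generators => [a b Aab|i].
  exact: (Ftilde_binomial suppB perp_q Aab).
apply: (euler_represents i Av BL repF) => u uL.
by rewrite /frob_coeff asboolF // => -[].
Qed.
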